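(* Let $m\in\mathbb{N}$ and let $\mathbb{T}$ be either $\mathbb{R}$ or $\mathbb{Z}$. Suppose that, for each $n\in\mathbb{N}_0$, $\{\mathbf{V}_{n1}(t),\ t\in\mathbb{T}\}$ and $\{\mathbf{V}_{n2}(t),\ t\in\mathbb{T}\}$ are $m$-variate stationary stochastic processes with $\mathrm{E}\,\mathbf{V}_{nk}(t)=\mathbf{0}$ and $\mathrm{cov}(\mathbf{V}_{nk}(t_1),\mathbf{V}_{nk}(t_2))=\mathbf{B}_n(t_1-t_2)$, $t_1,t_2\in\mathbb{T}$, $k=1,2$, and that the processes $\{\mathbf{V}_{n1}(t),t\in\mathbb{T}\}$ and $\{\mathbf{V}_{n2}(t),t\in\mathbb{T}\}$ ($n\in\mathbb{N}_0$) are (all together) independent. If $\sum_{n=0}^\infty\mathbf{B}_n(0)$ converges, then $$\mathbf{Z}(\mathbf{x};t)=\sum_{n=0}^\infty\bigl(\mathbf{V}_{n1}(t)\cos(n\theta)+\mathbf{V}_{n2}(t)\sin(n\theta)\bigr),\qquad \mathbf{x}=(\cos\theta,\sin\theta)'\in\mathbb{S}^1,\ t\in\mathbb{T},$$ is an $m$-variate random field on $\mathbb{S}^1\times\mathbb{T}$, with mean $\mathbf{0}$ and covariance matrix function $$\mathbf{C}(\vartheta;t)=\sum_{n=0}^\infty\mathbf{B}_n(t)\cos(n\vartheta),\qquad \vartheta\in[0,\pi],\ t\in\mathbb{T}.$$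
   Context: $\mathbb{N}$ is the set of positive integers and $\mathbb{N}_0$ the set of nonnegative integers. $\mathbb{S}^1=\{\mathbf{x}\in\mathbb{R}^2:\|\mathbf{x}\|=1\}$ is the unit circle; $\theta\in[0,2\pi]$ is the angular coordinate of $\mathbf{x}$. The spherical distance is $\vartheta(\mathbf{x}_1,\mathbf{x}_2)=\arccos(\mathbf{x}_1'\mathbf{x}_2)=\min(|\theta_1-\theta_2|,2\pi-|\theta_1-\theta_2|)$ for $\mathbf{x}_k=(\cos\theta_k,\sin\theta_k)'$. A prime denotes transpose. An $m$-variate random field is a family of $\mathbb{R}^m$-valued random vectors with finite second-order moments, and $\mathrm{cov}(\mathbf{X},\mathbf{Y})=\mathrm{E}\{(\mathbf{X}-\mathrm{E}\mathbf{X})(\mathbf{Y}-\mathrm{E}\mathbf{Y})'\}$. That the random field has covariance matrix function $\mathbf{C}(\vartheta;t)$ means $\mathrm{cov}(\mathbf{Z}(\mathbf{x}_1;t_1),\mathbf{Z}(\mathbf{x}_2;t_2))=\mathbf{C}(\vartheta(\mathbf{x}_1,\mathbf{x}_2);t_1-t_2)$ for all $\mathbf{x}_1,\mathbf{x}_2\in\mathbb{S}^1$, $t_1,t_2\in\mathbb{T}$. A stationary stochastic process is a wide-sense stationary one with finite second moments. The series defining $\mathbf{Z}(\mathbf{x};t)$ is understood in the mean square sense; convergence of series of matrices is entrywise. *)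

(* Defs.v *)
From HB Require Import structures.
From mathcomp Require Import all_boot all_order all_algebra finmap.
From mathcomp Require Import all_classical all_reals all_analysis.

Set Implicit Arguments.
Unset Strict Implicit.
Unset Printing Implicit Defensive.

Import Order.TTheory GRing.Theory Num.Theory.
Import numFieldTopology.Exports numFieldNormedType.Exports.

Local Open Scope classical_set_scope.
Local Open Scope ring_scope.

Section Circle.
Context {R : realType}.

Definition dotv k (u v : 'cV[R]_k) : R := (u^T *m v) 0 0.

(* The library norm on matrices is the sup norm. *)
Definition enorm k (u : 'cV[R]_k) : R := Num.sqrt (dotv u u).

Definition unit_circle : set 'cV[R]_2 := [set x | enorm x = 1].

Definition circle_point (theta : R) : 'cV[R]_2 :=
  \col_i (if i == 0 then cos theta else sin theta).

Definition sph_dist (x1 x2 : unit_circle) : R := acos (dotv (val x1) (val x2)).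

End Circle.
Arguments unit_circle R : clear implicits.

Inductive time_domain := RealTime | IntegerTime.

Definition time (R : realType) (tau : time_domain) : zmodType :=
  match tau with RealTime => R | IntegerTime => int end.

Section RandomVectors.
Context {d : measure_display} {Omega : measurableType d} {R : realType}.
Variable P : probability Omega R.

Definition comp_rv m (X : Omega -> 'cV[R]_m) (i : 'I_m) : Omega -> R :=
  fun w => X w i 0.

Definition random_vector m (X : Omega -> 'cV[R]_m) : Prop :=
  forall i, measurable_fun setT (comp_rv X i).

(* Membership in [Lfun P 2%:E] includes measurability. *)
Definition random_field (I : Type) m (X : I -> Omega -> 'cV[R]_m) : Prop :=
  forall a i, comp_rv (X a) i \in Lfun P 2%:E.

(* Means and covariances are extended-real valued in the library; an equation
   [mean_mx P X = map_mx EFin mu] therefore also asserts finiteness. *)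
Definition mean_mx m (X : Omega -> 'cV[R]_m) : 'cV[\bar R]_m :=
  \col_i expectation P (comp_rv X i).

Definition cov_mx m (X Y : Omega -> 'cV[R]_m) : 'M[\bar R]_m :=
  \matrix_(i, j) covariance P (comp_rv X i) (comp_rv Y j).

Definition stationary (T : zmodType) m (X : T -> Omega -> 'cV[R]_m) : Prop :=
  [/\ random_field X,
      exists mu : 'cV[R]_m, forall t, mean_mx (X t) = map_mx EFin mu
    & exists C : T -> 'M[R]_m, forall t1 t2,
        cov_mx (X t1) (X t2) = map_mx EFin (C (t1 - t2)) ].

(* The sigma-algebra generated by all the components X_t,i, t : T, i < m. *)
Definition process_sigma (T : Type) m (X : T -> Omega -> 'cV[R]_m)
    : set (set Omega) :=
  <<s \bigcup_(p in [set: T * 'I_m])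
        preimage_set_system setT (comp_rv (X p.1) p.2) measurable >>.

Definition independent_processes (I : choiceType) (T : Type) m
    (X : I -> T -> Omega -> 'cV[R]_m) : Prop :=
  forall (J : {fset I}) (E : I -> set Omega),
    (forall i, i \in J -> process_sigma (X i) (E i)) ->
    P (\bigcap_(i in [set` J]) E i) = (\prod_(i <- J) P (E i))%E.

Definition ms_cvg m (S : nat -> Omega -> 'cV[R]_m) (Z : Omega -> 'cV[R]_m)
    : Prop :=
  random_vector Z /\
  expectation P (fun w => enorm (S N w - Z w) ^+ 2) @[N --> \oo] --> 0%E.

End RandomVectors.

Section MatrixSeries.
Context {R : realType}.

Definition mx_series_cvg m (A : nat -> 'M[R]_m) : Prop :=
  forall i j, cvgn (series (fun n => A n i j)).

Definition mx_series_sum m (A : nat -> 'M[R]_m) : 'M[R]_m :=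
  \matrix_(i, j) limn (series (fun n => A n i j)).

End MatrixSeries.

Section Expansion.
Context {d : measure_display} {Omega : measurableType d} {R : realType}.
Variables (P : probability Omega R) (m : nat) (T : zmodType).

(* The two processes of order n are V n 0 (cosine) and V n 1 (sine). *)
Definition partial_expansion (V : nat -> 'I_2 -> T -> Omega -> 'cV[R]_m)
    (theta : R) (t : T) (N : nat) : Omega -> 'cV[R]_m :=
  fun w => \sum_(n < N) (cos (n%:R * theta) *: V n 0 t w
                         + sin (n%:R * theta) *: V n 1 t w).

(* The angle of a point is unique except for the pair 0, 2 pi, which yields the
   same series. Z is determined up to a null set for each (x, t). *)
Definition is_expansion (V : nat -> 'I_2 -> T -> Omega -> 'cV[R]_m)
    (Z : unit_circle R * T -> Omega -> 'cV[R]_m) : Prop :=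
  forall (x : unit_circle R) (theta : R) (t : T),
    0 <= theta <= 2 * pi -> val x = circle_point theta ->
    ms_cvg P (partial_expansion V theta t) (Z (x, t)).

Definition has_cov_mx_fun (Z : unit_circle R * T -> Omega -> 'cV[R]_m)
    (C : R -> T -> 'M[R]_m) : Prop :=
  forall (x1 x2 : unit_circle R) (t1 t2 : T),
    cov_mx P (Z (x1, t1)) (Z (x2, t2))
    = map_mx EFin (C (sph_dist x1 x2) (t1 - t2)).

End Expansion.

(* Main.v *)
Require Import Defs.
From HB Require Import structures.
From mathcomp Require Import all_boot all_order all_algebra finmap.
From mathcomp Require Import all_classical all_reals all_analysis.
From mathcomp Require Import measurable_realfun ring lra.

Set Implicit Arguments.
Unset Strict Implicit.
Unset Printing Implicit Defensive.

Import Order.TTheory GRing.Theory Num.Theory.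
Import numFieldTopology.Exports numFieldNormedType.Exports.

Local Open Scope classical_set_scope.
Local Open Scope ring_scope.

(** With respect to the inner product E[XY] on L^2(P), independence and the
    vanishing means make the processes V_(n,k) pairwise orthogonal, so that the
    partial sums at the angles a, b and the times t1, t2 satisfy
      E[S_N(a,t1)_i S_M(b,t2)_j]
        = \sum_(n < min N M) B_n(t1 - t2)_ij cos (n (a - b)),
    by the addition formula for the cosine.  By Cauchy-Schwarz, |B_n(t)_ij| is
    at most B_n(0)_ii + B_n(0)_jj, so these series converge absolutely; hence
    the partial sums are Cauchy in L^2, which is complete, and the covariances
    pass to the limit since the inner product is continuous.  Only cos of the
    spherical distance matters, because cos (n a) is a polynomial in cos a. *)

(** * The Hilbert space of square-integrable random variables *)

Section SecondOrder.
Context d (Omega : measurableType d) (R : realType) (P : probability Omega R).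
Implicit Types X Y Z W : Omega -> R.
Local Notation L2 := (Lfun P 2%:E).

Lemma Lfun2_measurable X : X \in L2 -> measurable_fun setT X.
Proof. by rewrite inE => /andP[/[!inE]]. Qed.

Lemma Lfun2P X : measurable_fun setT X ->
  (expectation P (fun w => X w ^+ 2)%R < +oo)%E -> X \in L2.
Proof.
move=> mX; rewrite unlock => X2; rewrite inE; apply/andP; split; rewrite inE//=.
rewrite /finite_norm unlock /= poweR_lty//; apply: le_lt_trans X2.
rewrite le_eqVlt; apply/orP; left; apply/eqP.
by apply: eq_integral => w _; rewrite /= powR_mulrn// real_normK// num_real.
Qed.

Lemma Lfun21 X : X \in L2 -> X \in Lfun P 1.
Proof. by move=> X2; apply: (Lfun_subset12 _ X2); exact: fin_num_measure. Qed.

Lemma Lfun2D X Y : X \in L2 -> Y \in L2 -> (fun w => X w + Y w) \in L2.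
Proof.
have p1 : (1 <= 2%:E :> \bar R)%E by rewrite lee1n.
by move=> X2 Y2; exact: (Lfun_addr_closed P p1).2.
Qed.

Lemma Lfun2Z a X : X \in L2 -> (fun w => a * X w) \in L2.
Proof.
move=> X2; have := @Lfun_scale _ _ _ P X a 2 _ X2.
rewrite (_ : a \o* X = fun w => a * X w); last first.
  by apply/funext => w /=; rewrite mulrC.
by apply; rewrite ler1n.
Qed.

Lemma Lfun2B X Y : X \in L2 -> Y \in L2 -> (fun w => X w - Y w) \in L2.
Proof.
move=> X2 Y2; have := Lfun2D X2 (Lfun2Z (-1) Y2).
by under eq_fun do rewrite mulN1r.
Qed.

Lemma Lfun2_sum (I : Type) (s : seq I) (F : I -> Omega -> R) :
  (forall i, F i \in L2) -> (fun w => \sum_(i <- s) F i w) \in L2.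
Proof.
move=> F2; elim: s => [|i s IH].
  under eq_fun do rewrite big_nil.
  exact: Lfun_cst.
under eq_fun do rewrite big_cons.
exact: Lfun2D.
Qed.

(* The inner product of L^2; [fine] makes it 0 when the expectation is infinite. *)
Definition ip X Y : R := fine (expectation P (fun w => X w * Y w)).

(** A product of two square-integrable variables is integrable, so [fine] loses nothing here. *)
Lemma ipE X Y : X \in L2 -> Y \in L2 ->
  expectation P (fun w => X w * Y w) = (ip X Y)%:E.
Proof.
move=> X2 Y2; rewrite /ip fineK// expectation_fin_num//.
exact: Lfun2_mul_Lfun1.
Qed.

Lemma ipC X Y : ip X Y = ip Y X.
Proof. by rewrite /ip; under eq_fun do rewrite mulrC. Qed.

Lemma ipDl X Y Z : X \in L2 -> Y \in L2 -> Z \in L2 ->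
  ip (fun w => X w + Y w) Z = ip X Z + ip Y Z.
Proof.
move=> X2 Y2 Z2; apply: EFin_inj; rewrite EFinD -!ipE ?Lfun2D//.
rewrite -expectationD ?Lfun2_mul_Lfun1//.
by congr (expectation P _); apply/funext => w /=; rewrite mulrDl.
Qed.

Lemma ipZl a X Y : X \in L2 -> Y \in L2 ->
  ip (fun w => a * X w) Y = a * ip X Y.
Proof.
move=> X2 Y2; apply: EFin_inj; rewrite EFinM -!ipE ?Lfun2Z//.
rewrite -expectationZl ?Lfun2_mul_Lfun1//.
by congr (expectation P _); apply/funext => w /=; rewrite -mulrA mulrC.
Qed.

Lemma ipDr X Y Z : X \in L2 -> Y \in L2 -> Z \in L2 ->
  ip X (fun w => Y w + Z w) = ip X Y + ip X Z.
Proof. by move=> *; rewrite ipC ipDl// !(ipC _ X). Qed.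

Lemma ipZr a X Y : X \in L2 -> Y \in L2 ->
  ip X (fun w => a * Y w) = a * ip X Y.
Proof. by move=> *; rewrite ipC ipZl// ipC. Qed.

Lemma ipBl X Y Z : X \in L2 -> Y \in L2 -> Z \in L2 ->
  ip (fun w => X w - Y w) Z = ip X Z - ip Y Z.
Proof.
move=> X2 Y2 Z2; rewrite -[- ip Y Z]mulN1r -ipZl// -ipDl ?Lfun2Z//.
by congr ip; apply/funext => w; rewrite mulN1r.
Qed.

Lemma ipBr X Y Z : X \in L2 -> Y \in L2 -> Z \in L2 ->
  ip X (fun w => Y w - Z w) = ip X Y - ip X Z.
Proof. by move=> *; rewrite ipC ipBl// !(ipC _ X). Qed.

Lemma ip_suml (I : Type) (s : seq I) (F : I -> Omega -> R) Y :
  (forall i, F i \in L2) -> Y \in L2 ->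
  ip (fun w => \sum_(i <- s) F i w) Y = \sum_(i <- s) ip (F i) Y.
Proof.
move=> F2 Y2; elim: s => [|i s IH].
  rewrite big_nil /ip; under eq_fun do rewrite big_nil mul0r.
  by rewrite expectation_cst.
rewrite big_cons -IH -ipDl ?Lfun2_sum//.
by congr ip; apply/funext => w; rewrite big_cons.
Qed.

Lemma ip_sumr (I : Type) (s : seq I) (F : I -> Omega -> R) Y :
  (forall i, F i \in L2) -> Y \in L2 ->
  ip Y (fun w => \sum_(i <- s) F i w) = \sum_(i <- s) ip Y (F i).
Proof.
by move=> F2 Y2; rewrite ipC ip_suml//; under eq_bigr do rewrite ipC.
Qed.

Lemma ip_ge0 X : 0 <= ip X X.
Proof. by apply: fine_ge0; apply: expectation_ge0 => w; rewrite -expr2 sqr_ge0. Qed.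

Lemma ip_cauchy_schwarz X Y : X \in L2 -> Y \in L2 ->
  ip X Y ^+ 2 <= ip X X * ip Y Y.
Proof.
move=> X2 Y2.
(* The square norm of [a X - b Y], used with [(a, b)] equal to
   [(<X,Y>, <X,X>)], or, when [X] is null, to [((<Y,Y> + 1) / <X,Y>, 1)]. *)
have q a b : 0 <= a ^+ 2 * ip X X - 2 * a * b * ip X Y + b ^+ 2 * ip Y Y.
  have := ip_ge0 (fun w => a * X w - b * Y w).
  rewrite ipBl ?ipBr ?ipZl ?ipZr ?Lfun2B ?Lfun2Z// (ipC Y X).
  by congr (_ <= _); ring.
have X0 := ip_ge0 X; have := q (ip X Y) (ip X X).
have [a0|Xn0] := eqVneq (ip X X) 0; last first.
  have Xgt0 : 0 < ip X X by rewrite lt_neqAle eq_sym Xn0 X0.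
  (* The form at this choice equals <X,X> (<X,X> <Y,Y> - <X,Y>^2), and the positive factor <X,X>
     cancels. *)
  by move=> qXY; rewrite -(ler_pM2l Xgt0) -subr_ge0; apply: le_trans qXY _; lra.
have [->|c0] := eqVneq (ip X Y) 0; first by rewrite a0 mul0r expr0n.
(* With <X,X> = 0 the form takes the value - <Y,Y> - 2, which is negative: a contradiction. *)
move=> _; have := q ((ip Y Y + 1) / ip X Y) 1; have := ip_ge0 Y.
rewrite a0 mulr1 -[2 * _ * _]mulrA divfK// => b0; nra.
Qed.

(** * Continuity of the inner product and of the expectation *)

Lemma cvg_ip0 (D F : nat -> Omega -> R) e :
  (forall n, D n \in L2) -> (forall n, F n \in L2) ->
  ip (D n) (D n) @[n --> \oo] --> (0 : R) -> ip (F n) (F n) @[n --> \oo] --> (e : R) ->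
  ip (D n) (F n) @[n --> \oo] --> (0 : R).
Proof.
move=> D2 F2 D0 Fe; apply/norm_cvg0P.
(* By Cauchy-Schwarz this square root dominates |<D_n,F_n>|; it tends to sqrt (0 * e) = 0. *)
have b : Num.sqrt (ip (D n) (D n) * ip (F n) (F n)) @[n --> \oo] --> (0 : R).
  rewrite (_ : 0 = Num.sqrt (0 * e)); last by rewrite mul0r sqrtr0.
  by apply: continuous_cvg; [exact: sqrt_continuous|exact: cvgM].
apply: (squeeze_cvgr _ (cvg_cst 0) b); near=> n; rewrite normr_ge0/=.
by rewrite -sqrtr_sqr ler_wsqrtr// ip_cauchy_schwarz.
Unshelve. all: by end_near. Qed.

Definition L2_cvg (X : nat -> Omega -> R) X' : Prop :=
  ip (fun w => X n w - X' w) (fun w => X n w - X' w) @[n --> \oo] --> (0 : R).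

Lemma L2_cvg_cst X : L2_cvg (fun=> X) X.
Proof.
rewrite /L2_cvg (_ : (fun=> _) = cst 0); first exact: cvg_cst.
apply/funext => n; rewrite /ip; under eq_fun do rewrite subrr mul0r.
by rewrite expectation_cst.
Qed.

(** Expanding around the limits, <X_n,Y_n> is <X',Y'> plus three inner products that each contain a
    difference tending to 0 and so vanish in the limit. *)
Lemma cvg_ip (X Y : nat -> Omega -> R) X' Y' :
  (forall n, X n \in L2) -> (forall n, Y n \in L2) -> X' \in L2 -> Y' \in L2 ->
  L2_cvg X X' ->
  L2_cvg Y Y' ->
  ip (X n) (Y n) @[n --> \oo] --> ip X' Y'.
Proof.
move=> X2 Y2 X'2 Y'2 Xc Yc.
have XB n : (fun w => X n w - X' w) \in L2 by exact: Lfun2B.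
have YB n : (fun w => Y n w - Y' w) \in L2 by exact: Lfun2B.
have c (W : Omega -> R) : ip W W @[_ --> \oo] --> (ip W W : R) by exact: cvg_cst.
have h1 := cvg_ip0 XB (fun=> Y'2) Xc (c _).
have h2 := cvg_ip0 YB (fun=> X'2) Yc (c _).
have h3 := cvg_ip0 XB YB Xc Yc.
have h0 : ip X' Y' @[_ --> \oo] --> (ip X' Y' : R) by exact: cvg_cst.
rewrite (_ : (fun n => ip (X n) (Y n)) = (fun n => ip X' Y' +
    ip (fun w => X n w - X' w) Y' + ip (fun w => Y n w - Y' w) X' +
    ip (fun w => X n w - X' w) (fun w => Y n w - Y' w))); last first.
  by apply/funext => n; rewrite !ipBl ?ipBr// !(ipC _ X'); ring.
rewrite -[ip X' Y' in X in _ --> X]addr0 -[_ + 0]addr0 -[_ + 0 + 0]addr0.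
by apply: cvgD h3; apply: cvgD h2; exact: cvgD h0 h1.
Qed.

(** Written as an inner product with the constant 1, the expectation inherits linearity and
    continuity in L^2. *)
Lemma expectation_ip X : X \in L2 -> expectation P X = (ip X (cst 1))%:E.
Proof.
move=> X2; rewrite -ipE ?Lfun_cst//.
by congr expectation; apply/funext => w; rewrite mulr1.
Qed.

Lemma cvg_expectation (X : nat -> Omega -> R) X' :
  (forall n, X n \in L2) -> X' \in L2 ->
  L2_cvg X X' ->
  (forall n, expectation P (X n) = 0%E) -> expectation P X' = 0%E.
Proof.
move=> X2 X'2 Xc X0; rewrite expectation_ip//.
have : ip (X n) (cst 1) @[n --> \oo] --> ip X' (cst 1).
  by apply: cvg_ip => // *; rewrite ?Lfun_cst//; exact: L2_cvg_cst.
have -> : (fun n => ip (X n) (cst 1)) = cst 0.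
  by apply/funext => n; apply: EFin_inj; rewrite -expectation_ip.
by move=> /cvg_lim <- //; rewrite lim_cst.
Qed.

(** * Completeness of L^2 *)

Lemma limn_einf_le (u : (\bar R)^nat) (e : \bar R) :
  (\forall n \near \oo, u n <= e)%E -> (limn_einf u <= e)%E.
Proof.
move=> [N _ uN]; apply: le_trans (limn_einf_sup _) _.
rewrite limn_esup_lim; apply: lime_le; first exact: is_cvg_esups.
exists N => // n /= Nn; apply: ge_ereal_sup => _ [k /= nk <-].
by apply: uN; exact: leq_trans nk.
Qed.

(** Cauchy-Schwarz for |X| and the constant 1, which has norm 1 since P is a probability. *)
Lemma expectation_norm_le X : X \in L2 ->
  (expectation P (fun w => `|X w|)%R <= (Num.sqrt (ip X X))%:E)%E.
Proof.
move=> X2; have mX := Lfun2_measurable X2.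
have nX2 : (fun w => `|X w|) \in L2.
  apply: Lfun2P; first exact: measurableT_comp.
  under eq_fun do rewrite real_normK ?num_real// expr2.
  by rewrite ipE// ltry.
rewrite expectation_ip// lee_fin; apply: le_trans (ler_norm _) _.
rewrite -sqrtr_sqr ler_wsqrtr//.
apply: le_trans (ip_cauchy_schwarz nX2 (Lfun_cst _ _ _)) _.
rewrite [ip (cst 1) _](_ : _ = 1) ?mulr1; last first.
  by rewrite /ip; under eq_fun do rewrite mulr1; rewrite expectation_cst.
rewrite le_eqVlt; apply/orP; left; apply/eqP; rewrite /ip; congr (fine _).
by congr expectation; apply/funext => w; rewrite -expr2 real_normK ?num_real.
Qed.

(** The increments have L^1 norms at most 2^-k, so the sum of their absolute values has finite
    expectation and is finite almost surely; there the telescoping series converges absolutely. *)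
Lemma ae_cvg_fast_cauchy (W : nat -> Omega -> R) :
  (forall n, W n \in L2) ->
  (forall k, ip (fun w => W k.+1 w - W k w) (fun w => W k.+1 w - W k w)
             <= (2^-1 ^+ k) ^+ 2) ->
  {ae P, forall w, cvgn (W ^~ w)}.
Proof.
move=> W2 WW.
pose D k w : R := `|W k.+1 w - W k w|.
have B2 k : (fun w => W k.+1 w - W k w) \in L2 by exact: Lfun2B.
have mD k : measurable_fun setT (EFin \o D k).
  by apply/measurable_EFinP; apply: measurableT_comp => //; exact: Lfun2_measurable.
have ED k : (\int[P]_w (D k w)%:E <= (2^-1 ^+ k)%:E)%E.
  have := expectation_norm_le (B2 k); rewrite unlock => /le_trans; apply.
  rewrite lee_fin; apply: le_trans (ler_wsqrtr (WW k)) _.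
  by rewrite sqrtr_sqr ger0_norm// exprn_ge0// invr_ge0.
have D0 k w : (0 <= (D k w)%:E)%E by rewrite lee_fin normr_ge0.
pose g w := (\sum_(0 <= k <oo) (D k w)%:E)%E.
have g0 w : (0 <= g w)%E by apply: nneseries_ge0.
have gint : P.-integrable setT g.
  apply/integrableP; split.
    apply: (ge0_emeasurable_sum (P := xpredT)) => [k w _ _|k _].
      exact: D0.
    exact: mD.
  under eq_integral do rewrite gee0_abs//.
  rewrite integral_nneseries//.
  apply: (@le_lt_trans _ _ (\sum_(0 <= k <oo) (2^-1 ^+ k : R)%:E)%E).
    by apply: lee_nneseries => // i _ _; exact: integral_ge0.
  have c : cvgn (series (geometric (1 : R) 2^-1)).
    by apply: is_cvg_geometric_series; rewrite ger0_norm ?invr_ge0// invf_lt1// ltr1n.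
  rewrite [X in (X < _)%E](_ : _ = (limn (series (geometric (1 : R) 2^-1)))%:E) ?ltry//.
  rewrite -EFin_lim//; congr (limn _); apply/funext => n /=.
  by rewrite sumEFin; congr EFin; apply: eq_bigr => i _; rewrite /= mul1r.
have := integrable_ae measurableT gint; apply: filterS => w /(_ I) gw.
have Wc : cvgn (series (fun k => W k.+1 w - W k w)).
  apply: normed_cvg; apply: nnseries_is_cvg => [n|]; first exact: normr_ge0.
  by rewrite -/(g w) ltey_eq gw.
rewrite (_ : W ^~ w = (fun n => W 0%N w + series (fun k => W k.+1 w - W k w) n)).
  by apply: is_cvgD => //; exact: is_cvg_cst.
by apply/funext => n; rewrite /series/= telescope_sumr// addrC subrK.
Qed.

(* Riesz-Fischer: a fast subsequence converges almost surely, and Fatou's lemma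
   turns the Cauchy estimate into an estimate of the distance to the limit. *)
Lemma L2_complete (Y : nat -> Omega -> R) :
  (forall n, Y n \in L2) ->
  (forall e : R, 0 < e -> exists N, forall m n, (N <= m)%N -> (N <= n)%N ->
     ip (fun w => Y m w - Y n w) (fun w => Y m w - Y n w) <= e) ->
  exists2 Z, Z \in L2 & L2_cvg Y Z.
Proof.
move=> Y2 cY.
have q0 k : 0 < (2^-1 ^+ k : R) ^+ 2 by rewrite !exprn_gt0// invr_gt0.
have /choice[N HN] : forall k, exists N, forall m n, (N <= m)%N -> (N <= n)%N ->
     ip (fun w => Y m w - Y n w) (fun w => Y m w - Y n w) <= (2^-1 ^+ k : R) ^+ 2.
  by move=> k; exact: cY.
(* Summing all ranks up to k makes [phi k] and [phi k.+1] both at least [N k] although [N] need not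
   be monotone; the summand [k] makes [phi] unbounded. *)
pose phi k := (k + \sum_(i < k.+1) N i)%N.
have phiN k : (N k <= phi k)%N.
  by rewrite /phi big_ord_recr/= addnA leq_addl.
have phiN' k : (N k <= phi k.+1)%N.
  apply: leq_trans (leq_addl _ _); rewrite big_ord_recr.
  by apply: leq_trans (leq_addr _ _); rewrite big_ord_recr leq_addl.
pose W k := Y (phi k).
have W2 k : W k \in L2 by exact: Y2.
have Wc : {ae P, forall w, cvgn (W ^~ w)}.
  by apply: ae_cvg_fast_cauchy => // k; exact: HN.
(* The upper limit is measurable everywhere, and is the limit almost surely. *)
pose Z w := fine (limn_esup (fun k => (W k w)%:E)).
have mZ : measurable_fun setT Z.
  apply: measurableT_comp; first exact: fine_measurable.
  by apply: measurable_fun_limn_esup => n; apply/measurable_EFinP; exact: Lfun2_measurable.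
have WZ : {ae P, forall w, W ^~ w @ \oo --> Z w}.
  apply: filterS Wc => w Ww.
  have /cvg_limn_einf_sup[_ h] : (fun k => (W k w)%:E) @ \oo --> (limn (W ^~ w))%:E.
    exact: cvg_comp Ww _.
  by rewrite /Z h.
(* A Cauchy bound passes to the limit. It serves twice: with e = 1 to place Z in L^2, then with
   arbitrary e for the convergence. *)
have key (e : R) M : 0 < e -> (forall m n, (M <= m)%N -> (M <= n)%N ->
     ip (fun w => Y m w - Y n w) (fun w => Y m w - Y n w) <= e) ->
  forall n, (M <= n)%N -> (expectation P (fun w => (Y n w - Z w) ^+ 2)%R <= e%:E)%E.
  move=> e0 HM n Mn; rewrite unlock.
  have mYZ : measurable_fun setT (EFin \o (fun w => (Y n w - Z w) ^+ 2)).
    apply/measurable_EFinP; apply: measurable_funX.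
    by apply: measurable_funB => //; exact: Lfun2_measurable.
  pose f k : Omega -> \bar R := EFin \o (fun w => (Y n w - W k w) ^+ 2).
  have mf k : measurable_fun setT (f k).
    apply/measurable_EFinP; apply: measurable_funX.
    by apply: measurable_funB; exact: Lfun2_measurable.
  have f0 k w : (0 <= f k w)%E by rewrite lee_fin sqr_ge0.
  (* The integrand is almost surely the lower limit of |Y_n - W_k|^2 in k, to which Fatou's lemma
     applies. *)
  rewrite (@ge0_ae_eq_integral _ _ _ P setT _ (fun w => limn_einf (f ^~ w))) //.
  - apply: le_trans (fatou P measurableT mf _) _ => //.
    apply: limn_einf_le; exists M => // k /= Mk.
    have -> : (\int[P]_w f k w = expectation P (fun w => (Y n w - W k w) * (Y n w - W k w))%R)%E.
      by rewrite unlock; apply: eq_integral => w _; rewrite /f /= expr2.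
    rewrite ipE ?Lfun2B// lee_fin HM//.
    by apply: leq_trans Mk _; rewrite /phi leq_addr.
  - apply: measurableT_comp => //; apply: measurable_fun_limn_esup => k.
    exact: measurableT_comp.
  - by move=> w _; rewrite lee_fin sqr_ge0.
  - move=> w _; rewrite limn_einf_lim; apply: lime_ge; first exact: is_cvg_einfs.
    by apply: nearW => k; apply: le_ereal_inf_tmp => _ [j _ <-].
  - apply: filterS WZ => w Ww _.
    have YW : Y n w - W k w @[k --> \oo] --> Y n w - Z w.
      by apply: cvgB => //; exact: cvg_cst.
    have /cvg_limn_einf_sup[h _] : f ^~ w @ \oo --> ((Y n w - Z w) ^+ 2)%:E.
      by apply: cvg_EFin; [exact: nearW|exact: (cvgM YW YW)].
    by rewrite h.
have [M HM] := cY _ ltr01.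
have Z2 : Z \in L2.
  have := key _ _ ltr01 HM _ (leqnn M) => h.
  have B2 : (fun w => Y M w - Z w) \in L2.
    apply: Lfun2P; last by apply: le_lt_trans h _; rewrite ltry.
    by apply: measurable_funB => //; exact: Lfun2_measurable.
  (* Z is recovered as Y_M - (Y_M - Z). *)
  have := Lfun2B (Y2 M) B2.
  by under eq_fun do rewrite opprB addrC subrK.
exists Z => //; apply/cvgr0Pnorm_le => e e0.
have [K HK] := cY _ e0.
exists K => // n Kn; rewrite ger0_norm ?ip_ge0// -lee_fin -ipE ?Lfun2B//.
by under eq_fun do rewrite -expr2; exact: key HK _ Kn.
Qed.

(** * Independence and covariance *)

Lemma expectation_independent X Y :
  X \in L2 -> Y \in L2 ->
  (forall A B, measurable A -> measurable B ->
     P (X @^-1` A `&` Y @^-1` B) = (P (X @^-1` A) * P (Y @^-1` B))%E) ->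
  expectation P (fun w => X w * Y w) = (expectation P X * expectation P Y)%E.
(* The joint distribution is the product of the marginals; conclude by Fubini. *)
Proof.
move=> X2 Y2 XY.
have mX := Lfun2_measurable X2; have mY := Lfun2_measurable Y2.
pose X' : {RV P >-> R} := MeasurableFun.Pack (MeasurableFun.Class
  (isMeasurableFun.Build _ _ _ _ X mX)).
pose Y' : {RV P >-> R} := MeasurableFun.Pack (MeasurableFun.Class
  (isMeasurableFun.Build _ _ _ _ Y mY)).
have mXY : measurable_fun setT (fun w => (X w, Y w)) by exact: measurable_fun_pair.
pose XY' : {mfun Omega >-> (R * R)%type} := MeasurableFun.Pack (MeasurableFun.Class
  (isMeasurableFun.Build _ _ _ _ (fun w => (X w, Y w)) mXY)).
pose muX : probability R R := distribution P X'.
pose muY : probability R R := distribution P Y'.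
pose muXY : probability (R * R)%type R := distribution P XY'.
have muE (A : set (R * R)) : measurable A -> (muX \x muY)%E A = muXY A.
  apply: product_measure_unique => {}A B mA mB.
  by rewrite -[RHS]XY.
pose f (z : R * R) := (z.1 * z.2)%:E.
have mf : measurable_fun setT f.
  by apply/measurable_EFinP; exact: measurable_funM.
have iX : P.-integrable setT (EFin \o X) by apply/Lfun1_integrable/Lfun21.
have iY : P.-integrable setT (EFin \o Y) by apply/Lfun1_integrable/Lfun21.
have iXY : P.-integrable setT (f \o XY').
  by have /Lfun1_integrable := Lfun2_mul_Lfun1 X2 Y2.
have imuXY : muXY.-integrable setT f by exact: integrable_pushforward.
(* Fubini needs integrability for the product measure; it is transferred from the joint
   distribution, where it is the integrability of XY. *)
have if' : (muX \x muY)%E.-integrable setT f.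
  have /integrableP[_ fi] := imuXY.
  apply/integrableP; split => //; apply: le_lt_trans fi.
  by rewrite (eq_measure_integral muXY)// => A mA _; exact: muE.
have -> : expectation P (fun w => X w * Y w) = (\int[muXY]_z f z)%E.
  by rewrite unlock integral_pushforward.
rewrite (eq_measure_integral (muX \x muY)%E); last first.
  by move=> A mA _; exact: esym (muE A mA).
rewrite -integral12_prod_meas1//.
have muXi : muX.-integrable setT EFin by exact: integrable_pushforward.
have muYi : muY.-integrable setT EFin by exact: integrable_pushforward.
have EX : expectation P X = (\int[muX]_x x%:E)%E.
  by rewrite unlock integral_pushforward.
have EY : expectation P Y = (\int[muY]_x x%:E)%E.
  by rewrite unlock integral_pushforward.
have EYfin := expectation_fin_num (Lfun21 Y2).
under eq_integral => x _.
  rewrite /fubini_F/f/=; under eq_integral do rewrite EFinM.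
  rewrite integralZl// -EY -(fineK EYfin).
  over.
by rewrite integralZr// -EX fineK.
Qed.

Lemma covariance_centered X Y :
  expectation P X = 0%E -> expectation P Y = 0%E ->
  X \in L2 -> Y \in L2 -> covariance P X Y = (ip X Y)%:E.
Proof.
move=> X0 Y0 X2 Y2; rewrite -ipE// unlock X0 Y0 /=.
by congr expectation; apply/funext => w; rewrite !fctE/= !subr0.
Qed.

End SecondOrder.

(** * Angles on the circle *)

Section Circle.
Context {R : realType}.
Implicit Types a b theta : R.

(** The Chebyshev recurrence cos ((k+2) c) = 2 cos c cos ((k+1) c) - cos (k c) involves c only
    through cosines; being of order two, it calls for an induction on two consecutive values. *)
Lemma cos_natmul_eq a b n : cos a = cos b -> cos (n%:R * a) = cos (n%:R * b).
Proof.
move=> ab.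
have rec c k : cos (k.+2%:R * c) = 2 * cos c * cos (k.+1%:R * c) - cos (k%:R * c).
  rewrite (_ : k.+2%:R * c = k.+1%:R * c + c); last by rewrite -natr1; ring.
  rewrite (_ : k%:R * c = k.+1%:R * c - c); last by rewrite -natr1; ring.
  by rewrite cosD cosB; ring.
suff [] : cos (n%:R * a) = cos (n%:R * b) /\ cos (n.+1%:R * a) = cos (n.+1%:R * b).
  by [].
elim: n => [|n [IH1 IH2]]; first by rewrite !mul0r !mul1r.
by split => //; rewrite !rec ab IH1 IH2.
Qed.

Lemma sin_natmul_eq a b n : cos a = cos b -> sin a = sin b ->
  sin (n%:R * a) = sin (n%:R * b).
Proof.
move=> ab sab; elim: n => [|n IH]; first by rewrite !mul0r.
by rewrite -natr1 !mulrDl !mul1r !sinD IH ab sab (cos_natmul_eq n ab).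
Qed.

Lemma dotvE k (u v : 'cV[R]_k) : dotv u v = \sum_i u i 0 * v i 0.
Proof. by rewrite /dotv mxE; apply: eq_bigr => i _; rewrite mxE. Qed.

Lemma enorm_sqr k (u : 'cV[R]_k) : enorm u ^+ 2 = \sum_i u i 0 ^+ 2.
Proof.
rewrite /enorm sqr_sqrtr dotvE; last by apply: sumr_ge0 => i _; rewrite -expr2 sqr_ge0.
by apply: eq_bigr => i _; rewrite expr2.
Qed.

Lemma dotv_circle_point a b : dotv (circle_point a) (circle_point b) = cos (a - b).
Proof. by rewrite dotvE !big_ord_recl big_ord0 !mxE/= addr0 cosB. Qed.

(** The spherical distance may differ from a - b by sign and by multiples of 2 pi, but the cosine
    does not see this. *)
Lemma cos_sph_dist (x1 x2 : unit_circle R) a b :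
  val x1 = circle_point a -> val x2 = circle_point b ->
  cos (sph_dist x1 x2) = cos (a - b).
Proof.
move=> x1a x2b; rewrite /sph_dist x1a x2b dotv_circle_point acosK//.
by rewrite in_itv/= cos_geN1 cos_le1.
Qed.

(** The angle is the arc cosine of the first coordinate on the closed upper half of the circle, and
    2 pi minus it on the lower half. *)
Lemma unit_circle_angle (x : unit_circle R) :
  exists2 theta, 0 <= theta <= 2 * pi & val x = circle_point theta.
Proof.
have : enorm (val x) ^+ 2 = 1 by have /set_mem -> := valP x; rewrite expr1n.
rewrite enorm_sqr !big_ord_recl big_ord0 addr0.
set p := val x 0 0; set q := val x _ 0 => pq.
have p11 : -1 <= p <= 1.
  by rewrite -ler_norml -(@ler_pXn2r _ 2) ?nnegrE// expr1n real_normK ?num_real//; nra.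
have sp : Num.sqrt (1 - p ^+ 2) = `|q| by rewrite -sqrtr_sqr; congr Num.sqrt; lra.
have cp (theta : R) : cos theta = p -> sin theta = q -> val x = circle_point theta.
  move=> cp sq; apply/matrixP => i j; rewrite ord1 mxE.
  case: ifPn => [/eqP ->|i0]; first by rewrite cp.
  rewrite sq; congr (val x _ 0); apply/val_inj => /=.
  by case: i i0 => -[|[|]].
have a0 := acos_ge0 p11; have api := acos_lepi p11.
have cacos : cos (acos p) = p by rewrite acosK// in_itv.
have [q0|q0] := leP 0 q.
  exists (acos p); first by rewrite a0/=; lra.
  by apply: cp => //; rewrite sin_acos// sp ger0_norm.
have e : 2 * pi - acos p = - acos p + pi *+ 2 by rewrite mulr2n; lra.
exists (2 * pi - acos p); first by apply/andP; split; lra.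
apply: cp; rewrite e ?cosD2pi ?sinD2pi ?cosN ?sinN// sin_acos// sp.
by rewrite ltr0_norm// opprK.
Qed.

End Circle.

(** * Mean square convergence of random vectors *)

Section MeanSquare.
Context d (Omega : measurableType d) (R : realType) (P : probability Omega R).
Variable m : nat.
Implicit Types (S : nat -> Omega -> 'cV[R]_m) (Z : Omega -> 'cV[R]_m).
Local Notation L2 := (Lfun P 2%:E).

(** The expected squared Euclidean norm is the finite sum of the squared L^2 distances of the
    components. *)
Lemma ms_cvg_intro S Z :
  (forall N i, comp_rv (S N) i \in L2) -> (forall i, comp_rv Z i \in L2) ->
  (forall i, L2_cvg P (fun N => comp_rv (S N) i) (comp_rv Z i)) -> ms_cvg P S Z.
Proof.
move=> S2 Z2 SZ; split; first by move=> i; exact: Lfun2_measurable (Z2 i).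
have B2 N i : (fun w => comp_rv (S N) i w - comp_rv Z i w) \in L2 by exact: Lfun2B.
pose e N i := ip P (fun w => comp_rv (S N) i w - comp_rv Z i w)
                   (fun w => comp_rv (S N) i w - comp_rv Z i w).
have -> : (fun N => expectation P (fun w => enorm (S N w - Z w) ^+ 2)%R) =
    (fun N => \sum_i (e N i)%:E)%E.
  apply/funext => N; rewrite unlock.
  under eq_integral => w _ do rewrite enorm_sqr -sumEFin.
  rewrite ge0_integral_sum//; last 2 first.
    move=> i; apply/measurable_EFinP; apply: measurable_funX.
    under eq_fun do rewrite !mxE.
    exact: Lfun2_measurable (B2 N i).
    by move=> i w _; rewrite lee_fin sqr_ge0.
  apply: eq_bigr => i _; rewrite /e -ipE// unlock; apply: eq_integral => w _.
  by rewrite !mxE expr2.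
rewrite [X in _ --> X](_ : _ = \sum_(i < m) 0)%E; last by rewrite big1.
apply: cvg_nnesum => i _; first by apply: nearW => N; rewrite lee_fin ip_ge0.
by apply: cvg_EFin; [exact: nearW|exact: SZ].
Qed.

(** Each squared component is dominated by the squared Euclidean norm. Square integrability of the
    limit is a conclusion. *)
Lemma ms_cvg_elim S Z i :
  (forall N i, comp_rv (S N) i \in L2) -> ms_cvg P S Z ->
  comp_rv Z i \in L2 /\ L2_cvg P (fun N => comp_rv (S N) i) (comp_rv Z i).
Proof.
move=> S2 [mZ]; set E := fun N => _; move=> E0.
have mB N j : measurable_fun setT (fun w => comp_rv (S N) j w - comp_rv Z j w).
  by apply: measurable_funB; [exact: Lfun2_measurable|exact: mZ].
have leE N : (expectation P (fun w => (comp_rv (S N) i w - comp_rv Z i w) ^+ 2)%R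
    <= E N)%E.
  apply: expectation_le.
  - exact: measurable_funX.
  - under eq_fun do rewrite enorm_sqr; apply: measurable_sum => j.
    by apply: measurable_funX; under eq_fun do rewrite !mxE; exact: mB.
  - by move=> w; exact: sqr_ge0.
  - by move=> w; exact: sqr_ge0.
  - apply: nearW => w; rewrite enorm_sqr (bigD1 i)//= !mxE lerDl.
    by apply: sumr_ge0 => j _; exact: sqr_ge0.
have [Efin fE0] := (fine_cvgP _ _).1 E0.
have Z2 : comp_rv Z i \in L2.
  (* The expectations are known to be finite only from some rank on; a single such N gives Z = S_N -
     (S_N - Z) in L^2, componentwise. *)
  have [N _ /(_ N (leqnn N)) /= EN] := Efin.
  have B2 : (fun w => comp_rv (S N) i w - comp_rv Z i w) \in L2.
    by apply: Lfun2P => //; apply: le_lt_trans (leE N) _; rewrite ltey_eq EN.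
  have := Lfun2B (S2 N i) B2.
  by under eq_fun do rewrite opprB addrC subrK.
split => //; apply: (squeeze_cvgr _ (cvg_cst 0) fE0).
apply: filterS Efin => N EN; rewrite ip_ge0/= -lee_fin -ipE ?Lfun2B// fineK//.
by under eq_fun do rewrite -expr2.
Qed.

End MeanSquare.

(** Orthogonality reduces the double sum for <S_N,S_M> to the diagonal indices below both N and
    M. *)
Lemma sum_diag (R : pzRingType) (a : nat -> R) N M :
  \sum_(n < N) \sum_(k < M) (n == k :> nat)%:R * a n = series a (minn N M).
Proof.
rewrite /series/= big_mkord (big_ord_widen _ _ (geq_minl N M)).
rewrite [RHS]big_mkcond; apply: eq_bigr => n _.
rewrite -big_distrl/=; case: ifPn => nm.
  have nM : (n < M)%N by rewrite (leq_trans nm) ?geq_minr.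
  rewrite (bigD1 (Ordinal nM))//= eqxx big1 ?addr0 ?mul1r// => k.
  by rewrite -val_eqE/= eq_sym => /negbTE ->.
rewrite big1 ?mul0r// => k _; case: eqP => // nk.
by move: nm; rewrite leq_min ltn_ord/= nk ltn_ord.
Qed.

(** * The random Fourier series *)

Section CosineExpansion.
Context (R : realType) d (Omega : measurableType d) (P : probability Omega R).
Variables (m : nat) (T : zmodType).
Variables (V : nat -> 'I_2 -> T -> Omega -> 'cV[R]_m) (B : nat -> T -> 'M[R]_m).
Hypothesis V_stationary : forall n k, stationary P (V n k).
Hypothesis V_mean : forall n k t, mean_mx P (V n k t) = map_mx EFin 0.
Hypothesis V_cov : forall n k t1 t2,
  cov_mx P (V n k t1) (V n k t2) = map_mx EFin (B n (t1 - t2)).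
Hypothesis V_indep : independent_processes P (fun nk : nat * 'I_2 => V nk.1 nk.2).
Hypothesis B_cvg : mx_series_cvg (fun n => B n 0).
Local Notation L2 := (Lfun P 2%:E).
Local Notation ip := (ip P).

(** * Orthogonality of the processes and bounds on their covariances *)

Lemma V_L2 n k t i : comp_rv (V n k t) i \in L2.
Proof. by have [V2 _ _] := V_stationary n k; exact: V2. Qed.

Lemma V_mean0 n k t i : expectation P (comp_rv (V n k t) i) = 0%E.
Proof. by have /matrixP/(_ i 0) := V_mean n k t; rewrite !mxE. Qed.

Lemma V_ip n k t1 t2 i j :
  ip (comp_rv (V n k t1) i) (comp_rv (V n k t2) j) = B n (t1 - t2) i j.
Proof.
have /matrixP/(_ i j) := V_cov n k t1 t2; rewrite !mxE.
by rewrite covariance_centered ?V_L2 ?V_mean0//; exact: EFin_inj.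
Qed.

(** Independence factors the expectation of the product, and both means vanish. This covers distinct
    orders as well as cosine against sine within one order. *)
Lemma V_ip_neq n k n' k' t1 t2 i j : (n, k) != (n', k') ->
  ip (comp_rv (V n k t1) i) (comp_rv (V n' k' t2) j) = 0.
Proof.
move=> nk; apply: EFin_inj; rewrite -ipE ?V_L2//.
rewrite expectation_independent ?V_L2 ?V_mean0 ?mule0// => A1 A2 mA1 mA2.
(* A family of events over all indices is required, but only its values at the two indices of the
   finite set matter. *)
pose E (p : nat * 'I_2) := if p == (n, k) then comp_rv (V n k t1) i @^-1` A1
                           else comp_rv (V n' k' t2) j @^-1` A2.
have E1 : E (n, k) = comp_rv (V n k t1) i @^-1` A1 by rewrite /E eqxx.
have E2 : E (n', k') = comp_rv (V n' k' t2) j @^-1` A2.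
  by rewrite /E eq_sym (negbTE nk).
have := @V_indep [fset (n, k); (n', k')]%fset E.
rewrite big_fsetU1 ?inE//= big_seq_fset1 E1 E2.
rewrite (_ : \bigcap_(p in _) E p = E (n, k) `&` E (n', k')); last first.
  apply/seteqP; split => [w Ew|w [w1 w2] p /=].
    by split; apply: Ew; rewrite /= !inE eqxx ?orbT.
  by rewrite !inE => /orP[/eqP ->|/eqP ->].
rewrite E1 E2; apply => p; rewrite !inE => /orP[/eqP ->|/eqP ->].
  (* The preimage under one component at one time is a generator of the sigma-algebra of the
     process. *)
  rewrite E1; apply: sub_gen_smallest; exists (t1, i) => //=.
  by exists A1 => //; rewrite setTI.
rewrite E2; apply: sub_gen_smallest; exists (t2, j) => //=.
by exists A2 => //; rewrite setTI.
Qed.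

(** Cauchy-Schwarz for the cosine process at times t and 0, together with stationarity, gives
    |B_n(t)_ij|^2 <= B_n(0)_ii B_n(0)_jj, which is at most the square of the sum. *)
Lemma B_bound n t i j : `|B n t i j| <= B n 0 i i + B n 0 j j.
Proof.
have := ip_cauchy_schwarz (V_L2 n 0 t i) (V_L2 n 0 0 j).
have := ip_ge0 P (comp_rv (V n 0 t) i); have := ip_ge0 P (comp_rv (V n 0 0) j).
rewrite !V_ip !subrr subr0 => b0 a0 ab.
rewrite -(@ler_pXn2r _ 2) ?nnegrE ?addr_ge0// real_normK ?num_real//; nra.
Qed.

Lemma cos_series_cvg a t i j :
  cvgn (series (fun n => cos (n%:R * a) * B n t i j)).
Proof.
apply: normed_cvg.
apply: (@series_le_cvg _ _ (fun n => B n 0 i i + B n 0 j j)).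
- by move=> n; exact: normr_ge0.
- by move=> n; exact: le_trans (normr_ge0 _) (B_bound n 0 i j).
- move=> n; apply: le_trans (B_bound n t i j).
  by rewrite /= normrM ler_piMl// cos_max.
- have Bc k : cvgn (series (fun n => B n 0 k k)) by exact: B_cvg.
  exact: (is_cvg_seriesD (Bc i) (Bc j)).
Qed.

(** * Partial sums and their mean square convergence *)

Definition term a t i n w : R :=
  cos (n%:R * a) * comp_rv (V n 0 t) i w + sin (n%:R * a) * comp_rv (V n 1 t) i w.

Lemma term_L2 a t i n : term a t i n \in L2.
Proof. by apply: Lfun2D; apply: Lfun2Z; exact: V_L2. Qed.

(** The mixed inner products vanish; the cosine and sine processes of order n share B_n, so cos cos
    + sin sin recombines into the cosine of the difference. *)
Lemma term_ip a1 a2 t1 t2 i j n k :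
  ip (term a1 t1 i n) (term a2 t2 j k) =
  (n == k)%:R * (cos (n%:R * (a1 - a2)) * B n (t1 - t2) i j).
Proof.
have VZ c n' k' t i' : (fun w => c * comp_rv (V n' k' t) i' w) \in L2.
  by apply: Lfun2Z; exact: V_L2.
rewrite /term ipDl ?ipDr ?Lfun2D// !ipZl ?V_L2// !ipZr ?V_L2//.
have [<-|nk] := eqVneq n k; last by rewrite !V_ip_neq ?xpair_eqE ?(negbTE nk)//= mulr0n; ring.
rewrite !V_ip !V_ip_neq ?xpair_eqE ?eqxx//.
rewrite mulrBr cosB mulr1n; ring.
Qed.

Lemma comp_partial_expansion a t N i :
  comp_rv (partial_expansion V a t N) i = fun w => \sum_(n < N) term a t i n w.
Proof.
apply/funext => w; rewrite /comp_rv /partial_expansion summxE.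
by apply: eq_bigr => n _; rewrite !mxE.
Qed.

Lemma partial_expansion_L2 a t N i : comp_rv (partial_expansion V a t N) i \in L2.
Proof. by rewrite comp_partial_expansion; apply: Lfun2_sum => n; exact: term_L2. Qed.

Lemma partial_expansion_mean0 a t N i :
  expectation P (comp_rv (partial_expansion V a t N) i) = 0%E.
Proof.
have V1 n k : ip (comp_rv (V n k t) i) (cst 1) = 0.
  by apply: EFin_inj; rewrite -expectation_ip ?V_L2 ?V_mean0.
rewrite expectation_ip ?partial_expansion_L2// comp_partial_expansion.
rewrite ip_suml ?Lfun_cst//; last by move=> n; exact: term_L2.
rewrite big1// => n _; rewrite ipDl ?Lfun2Z ?V_L2 ?Lfun_cst//.
by rewrite !ipZl ?V_L2 ?Lfun_cst// !V1 !mulr0 addr0.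
Qed.

(** Unequal ranks N and M serve the Cauchy property, equal ranks the limit of the covariances. *)
Lemma partial_expansion_ip a1 a2 t1 t2 i j N M :
  ip (comp_rv (partial_expansion V a1 t1 N) i)
     (comp_rv (partial_expansion V a2 t2 M) j) =
  series (fun n => cos (n%:R * (a1 - a2)) * B n (t1 - t2) i j) (minn N M).
Proof.
rewrite !comp_partial_expansion ip_suml; last 2 first.
- by move=> n; exact: term_L2.
- by apply: Lfun2_sum => n; exact: term_L2.
rewrite -sum_diag; apply: eq_bigr => n _.
rewrite ip_sumr ?term_L2//; last by move=> k; exact: term_L2.
by apply: eq_bigr => k _; rewrite term_ip.
Qed.

Lemma partial_expansion_cvg a t :
  exists Z, ms_cvg P (partial_expansion V a t) Z.
Proof.
suff /choice[Z HZ] : forall i, exists Zi, Zi \in L2 /\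
    L2_cvg P (fun N => comp_rv (partial_expansion V a t N) i) Zi.
  have cZ i : comp_rv (fun w => \col_i Z i w) i = Z i.
    by apply/funext => w; rewrite /comp_rv mxE.
  exists (fun w => \col_i Z i w); apply: ms_cvg_intro => [N i|i|i].
  - exact: partial_expansion_L2.
  - by rewrite cZ; have [] := HZ i.
  - by rewrite cZ; have [] := HZ i.
move=> i; suff [Z Z2 ZL] : exists2 Z, Z \in L2 &
    L2_cvg P (fun N => comp_rv (partial_expansion V a t N) i) Z by exists Z.
apply: L2_complete => [N|e e0]; first exact: partial_expansion_L2.
set s := series (fun n => cos (n%:R * (a - a)) * B n (t - t) i i).
have /cvg_ex[l sl] : cvgn s by exact: cos_series_cvg.
have e20 : 0 < e / 2 by rewrite divr_gt0.
have /cvgrPdist_le/(_ _ e20)[N _ HN] := sl.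
exists N => p q Np Nq.
(* The squared distance of two partial sums is s_p + s_q - 2 s_min(p,q), the gap between s_p and
   s_q, each within e / 2 of the limit. *)
rewrite ipBl ?ipBr ?Lfun2B ?partial_expansion_L2// !partial_expansion_ip -/s.
rewrite !minnn (minnC q p).
have := HN p Np; have := HN q Nq; rewrite /= !ler_norml => /andP[? ?] /andP[? ?].
by case: (leqP p q) => _; lra.
Qed.

Lemma partial_expansion_eq a b t :
  circle_point a = circle_point b -> partial_expansion V a t = partial_expansion V b t.
Proof.
move=> ab; have := congr1 (fun u : 'cV[R]_2 => u 0 0) ab.
have := congr1 (fun u : 'cV[R]_2 => u 1 0) ab; rewrite !mxE/= => sab cab.
apply/funext => N; apply/funext => w; apply: eq_bigr => n _.
by rewrite (cos_natmul_eq _ cab) (sin_natmul_eq _ cab sab).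
Qed.

(** One limit is chosen for each point and time. It serves every admissible angle of the point,
    since these give the same partial sums. *)
Lemma expansion_exists : exists Z, is_expansion P V Z.
Proof.
suff /choice[Z HZ] : forall xt : unit_circle R * T, exists Z, forall theta,
    0 <= theta <= 2 * pi -> val xt.1 = circle_point theta ->
    ms_cvg P (partial_expansion V theta xt.2) Z.
  by exists Z => x theta t; exact: (HZ (x, t)).
move=> [x t]/=; have [a _ xa] := unit_circle_angle x.
have [Z aZ] := partial_expansion_cvg a t.
by exists Z => b _ xb; rewrite (@partial_expansion_eq b a)// -xa -xb.
Qed.

Section Moments.
Variable Z : unit_circle R * T -> Omega -> 'cV[R]_m.
Hypothesis VZ : is_expansion P V Z.

Lemma expansion_L2 x a t i : 0 <= a <= 2 * pi -> val x = circle_point a ->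
  comp_rv (Z (x, t)) i \in L2 /\
  L2_cvg P (fun N => comp_rv (partial_expansion V a t N) i) (comp_rv (Z (x, t)) i).
Proof.
move=> ha xa; apply: ms_cvg_elim; last exact: VZ.
by move=> N j; exact: partial_expansion_L2.
Qed.

Lemma expansion_random_field : random_field P Z.
Proof.
move=> [x t] i; have [a ha xa] := unit_circle_angle x.
by have [] := expansion_L2 t i ha xa.
Qed.

Lemma expansion_mean0 xt i : expectation P (comp_rv (Z xt) i) = 0%E.
Proof.
case: xt => x t; have [a ha xa] := unit_circle_angle x.
have [Z2 ZL] := expansion_L2 t i ha xa.
apply: (cvg_expectation _ Z2 ZL) => N; first exact: partial_expansion_L2.
exact: partial_expansion_mean0.
Qed.

Lemma expansion_cov : has_cov_mx_fun P Z (fun vartheta t =>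
  mx_series_sum (fun n => cos (n%:R * vartheta) *: B n t)).
Proof.
move=> x1 x2 t1 t2; apply/matrixP => i j; rewrite !mxE.
have [a1 ha1 xa1] := unit_circle_angle x1.
have [a2 ha2 xa2] := unit_circle_angle x2.
have [Z12 ZL1] := expansion_L2 t1 i ha1 xa1.
have [Z22 ZL2] := expansion_L2 t2 j ha2 xa2.
rewrite covariance_centered ?expansion_mean0//; congr EFin.
have S2 a t k N := partial_expansion_L2 a t N k.
have := cvg_ip (S2 a1 t1 i) (S2 a2 t2 j) Z12 Z22 ZL1 ZL2.
(* At equal ranks the inner products are exactly the partial sums of the covariance series at the
   angle a1 - a2. *)
under eq_fun do rewrite partial_expansion_ip minnn.
move=> /cvg_lim <- //; congr (limn (series _)); apply/funext => n.
by rewrite mxE (cos_natmul_eq _ (cos_sph_dist xa1 xa2)).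
Qed.

End Moments.
End CosineExpansion.

(** A mean square limit is determined only up to null sets, so existence is asserted separately and
    the moments are computed for every version Z of the sum. *)
Theorem theorem5 (R : realType) (d : measure_display)
    (Omega : measurableType d) (P : probability Omega R)
    (m : nat) (m_gt0 : (0 < m)%N) (tau : time_domain)
    (V : nat -> 'I_2 -> time R tau -> Omega -> 'cV[R]_m)
    (B : nat -> time R tau -> 'M[R]_m)
    (V_stationary : forall n k, stationary P (V n k))
    (V_mean : forall n k t, mean_mx P (V n k t) = map_mx EFin 0)
    (V_cov : forall n k t1 t2,
       cov_mx P (V n k t1) (V n k t2) = map_mx EFin (B n (t1 - t2)))
    (V_indep : independent_processes P (fun nk : nat * 'I_2 => V nk.1 nk.2))
    (B_cvg : mx_series_cvg (fun n => B n 0)) :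
  [/\ exists Z : unit_circle R * time R tau -> Omega -> 'cV[R]_m,
        is_expansion P V Z,
      forall (vartheta : R) (t : time R tau), 0 <= vartheta <= pi ->
        mx_series_cvg (fun n => cos (n%:R * vartheta) *: B n t)
    & forall Z : unit_circle R * time R tau -> Omega -> 'cV[R]_m,
        is_expansion P V Z ->
        [/\ random_field P Z,
            forall xt, mean_mx P (Z xt) = map_mx EFin 0
          & has_cov_mx_fun P Z (fun vartheta t =>
              mx_series_sum (fun n => cos (n%:R * vartheta) *: B n t)) ] ].
Proof.
split.
- exact: expansion_exists V_stationary V_mean V_cov V_indep B_cvg.
- move=> a t _ i j; under eq_fun do rewrite mxE.
  exact: cos_series_cvg V_stationary V_mean V_cov B_cvg _ _ _ _.
- move=> Z VZ; split.
  + exact: expansion_random_field V_stationary _ VZ.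
  + move=> xt; apply/matrixP => i j; rewrite !mxE.
    exact: expansion_mean0 V_stationary V_mean _ VZ _ _.
  + exact: expansion_cov V_stationary V_mean V_cov V_indep _ VZ.
Qed.
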